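(* $n(8,7) \leq 774$; that is, there exists an $8$-regular graph of girth exactly $7$ with at most $774$ vertices.
   Context: Graphs are finite and simple. For integers $k\ge 2$, $g\ge 3$, a $(k,g)$-graph is a $k$-regular graph with girth $g$ (the length of a shortest cycle is exactly $g$). $n(k,g)$ denotes the smallest possible number of vertices of a $(k,g)$-graph. *)

(* Defs.v *)
From mathcomp Require Import all_boot.

Set Implicit Arguments.
Unset Strict Implicit.
Unset Printing Implicit Defensive.

(* A finite simple graph is a symmetric irreflexive adjacency relation on a
   finite type of vertices. *)
Definition simple_graph (T : finType) (e : rel T) : Prop :=
  symmetric e /\ irreflexive e.

Definition regular (T : finType) (e : rel T) (k : nat) : Prop :=
  forall x : T, #|[set y | e x y]| = k.

(* [ucycle] also accepts the empty sequence and, in a symmetric graph, every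
   edge traversed back and forth; the bound on the size excludes both. *)
Definition graph_cycle (T : finType) (e : rel T) (c : seq T) : Prop :=
  ucycle e c /\ 3 <= size c.

Definition has_girth (T : finType) (e : rel T) (g : nat) : Prop :=
  (exists c : seq T, graph_cycle e c /\ size c = g) /\
  (forall c : seq T, graph_cycle e c -> g <= size c).

Definition kg_graph (k g : nat) (T : finType) (e : rel T) : Prop :=
  [/\ simple_graph e, regular e k & has_girth e g].

(* n(k,g) = n, as a relation: the value n(k,g) is only defined when some
   (k,g)-graph exists. *)
Definition is_min_order (k g n : nat) : Prop :=
  (exists (T : finType) (e : rel T), kg_graph k g e /\ #|T| = n) /\
  (forall (T : finType) (e : rel T), kg_graph k g e -> n <= #|T|).

(* Main.v *)
(* The incidence graph of the symplectic generalized quadrangle W(7) is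
   8-regular of girth 8 on 800 vertices.  Realise W(7) on V = F^2 (+) F^2,
   F = F_7, with the form <(a,b),(c,d)> = det(a,d) + det(b,c).  Delete the
   opposite lines x = F^2 (+) 0 and y = 0 (+) F^2, the eight lines
   z_v = {(v, t v)} joining a point p_v of x to the point q_v of y orthogonal
   to it, and the 16 points p_v, q_v.  This leaves 774 vertices, and the
   deficient ones (degree 7) are the six other points (v, t v) of each z_v, the
   six other lines X_(v,c) through each p_v and the six other lines Y_(v,d)
   through each q_v.  Each of these 24 sixes gets a perfect matching.  A cycle
   shorter than 7 could only come from two matched pairs joined by two paths of
   length 2.  Now (v, t v) and (w, s w) are collinear, for v <> w, iff s = - t,
   and X_(v,c) meets Y_(u,d) iff c d = - det(v,u)^2, so these cycles are avoided
   by three matchings of the nonzero scalars, the same for all v: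
   m = {1,3},{2,6},{4,5} for t and for c, because - m is disjoint from m, and
   {d,-d} for d, because it is disjoint from m, which is invariant under
   squares and under c |-> -1/c. *)

Require Import Defs.
From HB Require Import structures.
From Stdlib Require Import NArith FMapPositive MSetPositive Wf_nat Classical_Prop.
From mathcomp Require Import all_boot.

Set Implicit Arguments.
Unset Strict Implicit.
Unset Printing Implicit Defensive.

(** * Graphs given by adjacency lists *)

Lemma map_uniq_inj_in (T1 T2 : eqType) (f : T1 -> T2) (s : seq T1) :
  uniq (map f s) -> {in s &, injective f}.
Proof.
elim: s => //= a s IHs /andP[fa_s /IHs inj_s] x y.
rewrite !inE => /predU1P[-> | xs] /predU1P[-> | ys] // eq_f.
- by rewrite eq_f map_f in fa_s.
- by rewrite -eq_f map_f in fa_s.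
exact: inj_s.
Qed.

(* Walks of length at most 3; the starting point x is left out of each. *)
Definition reduced_walks (V : eqType) (adj : V -> seq V) (x : V) : seq (seq V) :=
  [::] :: flatten [seq [:: y] ::
     flatten [seq [:: y; z] :: [seq [:: y; z; w] | w <- adj z & w != y]
             | z <- adj y & z != x]
  | y <- adj x].

Section AdjacencyLists.

Variables (V : eqType) (adj : V -> seq V).

Lemma mem_reduced_walks1 x y : y \in adj x -> [:: y] \in reduced_walks adj x.
Proof.
move=> xy; rewrite inE; apply/orP; right.
by apply/flatten_mapP; exists y => //; rewrite inE eqxx.
Qed.

Lemma mem_reduced_walks2 x y z :
  y \in adj x -> z \in adj y -> z != x -> [:: y; z] \in reduced_walks adj x.
Proof.
move=> xy yz zx; rewrite inE; apply/orP; right.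
apply/flatten_mapP; exists y => //; rewrite inE; apply/orP; right.
by apply/flatten_mapP; exists z; rewrite ?mem_filter ?zx // inE eqxx.
Qed.

Lemma mem_reduced_walks3 x y z w :
    y \in adj x -> z \in adj y -> w \in adj z -> z != x -> w != y ->
  [:: y; z; w] \in reduced_walks adj x.
Proof.
move=> xy yz zw zx wy; rewrite inE; apply/orP; right.
apply/flatten_mapP; exists y => //; rewrite inE; apply/orP; right.
apply/flatten_mapP; exists z; rewrite ?mem_filter ?zx // inE; apply/orP; right.
by apply/mapP; exists w; rewrite // mem_filter wy.
Qed.

Definition uniq_reduced_ends (x : V) : bool :=
  uniq [seq last x p | p <- reduced_walks adj x].

Lemma notin_adj_self x : uniq_reduced_ends x -> x \notin adj x.
Proof.
move=> /map_uniq_inj_in inj_x; apply/negP => /mem_reduced_walks1 xx.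
by have := inj_x [::] _ (mem_head _ _) xx erefl.
Qed.

(** A cycle of length at most 6 through [x] splits into two distinct reduced walks from [x], of
    length at most 3, with a common end. *)
Lemma ucycle_size_ge7 (vs c : seq V) :
    {in vs &, forall x y, y \in adj x -> x \in adj y} ->
    {in vs, forall x, uniq_reduced_ends x} ->
    {subset c <= vs} -> ucycle (grel adj) c -> 3 <= size c ->
  7 <= size c.
Proof.
move=> symV uniqV; case: c => [|x [|y [|z c]]] // /allP sub_c /andP[].
have /= /andP[x_vs _] := sub_c; have inj_x := map_uniq_inj_in (uniqV _ x_vs).
have w1 := @mem_reduced_walks1 x; have w2 := @mem_reduced_walks2 x.
have w3 := @mem_reduced_walks3 x.
case: c sub_c => [|t [|u [|v [|? c]]]] //=; rewrite !inE !negb_or !andbT.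
- move=> /and3P[xs ys zs] /and3P[xy yz zx] /andP[/andP[xNy xNz] yNz] _.
  have zx' := symV _ _ zs xs zx.
  have := inj_x _ _ (w1 _ zx') (w2 _ _ xy yz _) erefl.
  by rewrite eq_sym => /(_ xNz).
- move=> /and4P[xs ys zs ts] /and4P[xy yz zt tx].
  move=> /and3P[/and3P[xNy xNz xNt] /andP[yNz yNt] zNt] _.
  have tx' := symV _ _ ts xs tx; have zt' := symV _ _ zs ts zt.
  have := inj_x _ _ (w2 _ _ xy yz _) (w2 _ _ tx' zt' _) erefl.
  by rewrite eq_sym => /(_ xNz xNz) [] /eqP; rewrite (negPf yNt).
- move=> /and5P[xs ys zs ts us] /and5P[xy yz zt tu ux].
  move=> /and4P[/and4P[xNy xNz xNt xNu] /and3P[yNz yNt yNu] _ _] _.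
  have ux' := symV _ _ us xs ux; have tu' := symV _ _ ts us tu.
  have := inj_x _ _ (w3 _ _ _ xy yz zt _ _) (w2 _ _ ux' tu' _) erefl.
  by rewrite (eq_sym z) (eq_sym t) (eq_sym t) => /(_ xNz yNt xNt).
move=> /and5P[xs ys zs ts /andP[us vs']] /and5P[xy yz zt tu /andP[uv vx]].
move=> /and5P[/and5P[xNy xNz xNt xNu xNv] /and4P[yNz yNt yNu yNv]].
move=> /and3P[zNt zNu zNv] /andP[tNu tNv] uNv _.
have vx' := symV _ _ vs' xs vx; have uv' := symV _ _ us vs' uv.
have tu' := symV _ _ ts us tu.
have := inj_x _ _ (w3 _ _ _ xy yz zt _ _) (w3 _ _ _ vx' uv' tu' _ _) erefl.
rewrite (eq_sym z) (eq_sym t y) (eq_sym u) => /(_ xNz yNt xNu tNv) [] /eqP.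
by rewrite (negPf yNv).
Qed.

End AdjacencyLists.

Lemma adj_list_kg_graph (V : choiceType) (adj : V -> seq V) (vs c : seq V) k :
    {in vs, forall x, {subset adj x <= vs}} ->
    {in vs, forall x, uniq (adj x) /\ size (adj x) = k} ->
    {in vs &, forall x y, y \in adj x -> x \in adj y} ->
    {in vs, forall x, uniq_reduced_ends adj x} ->
    {subset c <= vs} -> ucycle (grel adj) c -> size c = 7 ->
  kg_graph k 7 (relpre (val : seq_sub vs -> V) (grel adj)).
Proof.
move=> adj_vs adj_k symV uniqV c_vs /andP[cyc_c uniq_c] sz_c; split.
- split=> [[x xs] [y ys] | [x xs]]; rewrite /=.
    by apply/idP/idP; apply: symV.
  exact/negbTE/notin_adj_self/uniqV.
- move=> x; have [uniq_x <-] := adj_k _ (valP x).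
  rewrite cardE -(size_map val); apply/perm_size/uniq_perm => //.
    by rewrite (map_inj_uniq val_inj) enum_uniq.
  move=> y; apply/mapP/idP => [[z] | xy]; first by rewrite mem_enum inE => xz ->.
  by exists (SeqSub (adj_vs _ (valP x) _ xy)); rewrite // mem_enum inE.
split=> [|d [/andP[cyc_d uniq_d] sz_d]].
  pose d := pmap (insub : V -> option (seq_sub vs)) c.
  have dE : map val d = c.
    rewrite (pmap_filter (@insubK _ _ _)) -[RHS]filter_predT.
    by apply: eq_in_filter => y /c_vs ys; rewrite /= insubT.
  have sz_d : size d = 7 by rewrite -(size_map val) dE.
  exists d; split=> //; split; last by rewrite sz_d.
  by rewrite /ucycle -cycle_map dE cyc_c -(map_inj_uniq val_inj) dE.
rewrite -(size_map val); apply: (ucycle_size_ge7 symV uniqV).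
- by move=> _ /mapP[y _ ->]; apply: valP.
- by rewrite /ucycle cycle_map cyc_d (map_inj_uniq val_inj).
by rewrite size_map.
Qed.

(** * The graph *)

HB.instance Definition _ := Choice.copy N (can_type nat_of_binK).

Section Graph.

Local Open Scope N_scope.

Definition mod7 (a : N) : N := N.modulo a 7.
Definition neg7 (a : N) : N := mod7 (7 - a).
Definition inv7 (a : N) : N := mod7 (a ^ 5).

Definition lcomb (s : N) (a : N * N) (t : N) (b : N * N) : N * N :=
  (mod7 (s * a.1 + t * b.1), mod7 (s * a.2 + t * b.2)).
Definition scale (t : N) (a : N * N) : N * N := lcomb t a 0 (0, 0).
Definition det (a b : N * N) : N := mod7 (a.1 * b.2 + neg7 (mod7 (a.2 * b.1))).

Definition F7 : seq N := [:: 0; 1; 2; 3; 4; 5; 6].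
Definition F7star : seq N := [:: 1; 2; 3; 4; 5; 6].

(* The projective line is {0, ..., 7}, where i < 7 stands for <(1, i)> and 7
   for <(0, 1)>.  The vectors covec i are chosen with det (vec i) (covec i) = 1. *)
Definition PF7 : seq N := rcons F7 7.
Definition vec (i : N) : N * N := if i == 7 then (0, 1) else (1, i).
Definition covec (i : N) : N * N := if i == 7 then (6, 0) else (0, 1).

(* A nonzero vector a is lead a times vec (dir a). *)
Definition lead (a : N * N) : N := if a.1 == 0 then a.2 else a.1.
Definition dir (a : N * N) : N := if a.1 == 0 then 7 else mod7 (a.2 * inv7 a.1).

Definition mate (t : N) : N := nth 0 [:: 0; 3; 6; 1; 5; 4; 2] t.

(* Vertices are octal numerals.  Besides the points <(a, b)>, the vertices are
   - the lines {(a, M a)} with M = [[p, q], [r, -p]] invertible: the graph of M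
     is totally isotropic iff M has trace 0;
   - the lines X_(i,c) spanned by (v, 0) and (c w, v),
   - the lines Y_(i,d) spanned by (0, v) and (v, d w), for v = vec i and
     w = covec i.
   The digit 7 in lineX keeps its codes apart from those of the matrices. *)
Definition code (h a b c : N) : N := h * 512 + a * 64 + b * 8 + c.
Definition point (a b : N * N) : N :=
  let b' := scale (inv7 (lead a)) b in code 0 (dir a) b'.1 b'.2.
Definition matline (p q r : N) : N := code 1 p q r.
Definition lineX (i c : N) : N := code 1 7 i c.
Definition lineY (i d : N) : N := code 2 0 i d.

Definition graph_line (f : N * N -> N * N) : N :=
  matline (f (1, 0)).1 (f (0, 1)).1 (f (1, 0)).2.

(* The lines graph_line M through <(a, b)> are given by M a = b.  If b = t a,
   trace 0 means that M w = - t w + s a where det a w = 1; otherwise it means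
   that M b = s a. *)
Definition point_nbrs (i : N) (b : N * N) : seq N :=
  let a := vec i in let w := covec i in let D := det a b in
  if D == 0 then
    let t := det b w in
    point a (scale (mate t) a) ::
      [seq graph_line (fun x =>
         lcomb (det x w) (scale t a) (det a x) (lcomb (neg7 t) w s a)) | s <- F7]
  else
    let m := inv7 (lead b) in
    [:: lineX (dir b) (det (scale m b) (scale m a)), lineY i D &
      [seq graph_line (fun x =>
         scale (inv7 D) (lcomb (det x b) b (det a x) (scale s a))) | s <- F7star]].

Definition matline_nbrs (p q r : N) : seq N :=
  [seq point (vec i) (lcomb (vec i).1 (p, r) (vec i).2 (q, neg7 p)) | i <- PF7].

Definition lineX_nbrs (i c : N) : seq N :=
  lineX i (mate c) :: [seq point (lcomb s (vec i) c (covec i)) (vec i) | s <- F7].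

Definition lineY_nbrs (i d : N) : seq N :=
  lineY i (neg7 d) :: [seq point (vec i) (lcomb s (vec i) d (covec i)) | s <- F7].

Definition adj_list : seq (N * seq N) :=
  [seq (point (vec i) b, point_nbrs i b) |
     i <- PF7, b <- [seq b <- [seq (b1, b2) | b1 <- F7, b2 <- F7] | b != (0, 0)]] ++
  flatten [seq [seq (matline m.1 m.2 r, matline_nbrs m.1 m.2 r) |
                  r <- F7 & mod7 (m.1 * m.1 + m.2 * r) != 0] |
             m <- [seq (p, q) | p <- F7, q <- F7]] ++
  [seq (lineX i c, lineX_nbrs i c) | i <- PF7, c <- F7star] ++
  [seq (lineY i d, lineY_nbrs i d) | i <- PF7, d <- F7star].

Definition vertices : seq N := [seq x.1 | x <- adj_list].

Definition adj_map : PositiveMap.t (seq N) :=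
  foldr (fun x m => PositiveMap.add (N.succ_pos x.1) x.2 m)
    (PositiveMap.empty (seq N)) adj_list.

Definition adj (x : N) : seq N :=
  odflt [::] (PositiveMap.find (N.succ_pos x) adj_map).

(** An odd cycle needs a matching edge: here 1018 and 1022 are [lineX 7 2] and [lineX 7 6]. *)
Definition cycle7 : seq N := [:: 1; 561; 113; 846; 131; 1018; 1022].

End Graph.

(* uniq takes quadratic time, too slow for the 457 walks from each vertex. *)
Fixpoint distinct_from (seen : PositiveSet.t) (s : seq N) : bool :=
  if s is x :: s' then
    ~~ PositiveSet.mem (N.succ_pos x) seen &&
    distinct_from (PositiveSet.add (N.succ_pos x) seen) s'
  else true.

Lemma distinct_from_uniq seen s :
  distinct_from seen s ->
  uniq s /\ {in s, forall x, ~~ PositiveSet.mem (N.succ_pos x) seen}.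
Proof.
elim: s seen => //= x s IHs seen /andP[x_seen /IHs[uniq_s s_seen]].
rewrite uniq_s andbT; split.
  apply/negP => /s_seen/negP; apply.
  by apply/PositiveSet.mem_spec/PositiveSet.add_spec; left.
move=> y; rewrite inE => /predU1P[-> // | /s_seen]; apply: contra.
move=> /PositiveSet.mem_spec y_seen.
by apply/PositiveSet.mem_spec/PositiveSet.add_spec; right.
Qed.

(** * Verification by computation *)

Definition good_vertex (x : N) : bool :=
  [&& uniq (adj x), size (adj x) == 8, all (fun y => x \in adj y) (adj x) &
      distinct_from PositiveSet.empty [seq last x p | p <- reduced_walks adj x]].

Lemma good_vertices : all good_vertex vertices.
Proof. by vm_compute. Qed.

Lemma uniq_vertices : uniq vertices.
Proof.
have /distinct_from_uniq[] // : distinct_from PositiveSet.empty vertices.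
by vm_compute.
Qed.

Lemma size_vertices : size vertices = 774.
Proof. by vm_compute. Qed.

Lemma adj_vertices : {in vertices, forall x, {subset adj x <= vertices}}.
Proof.
suff /allP adjP : all (fun x => all (mem vertices) (adj x)) vertices.
  by move=> x /adjP/allP.
by vm_compute.
Qed.

Lemma adj_kg_graph :
  kg_graph 8 7 (relpre (val : seq_sub vertices -> N) (grel adj)).
Proof.
have uniq_ends : {in vertices, forall x, uniq_reduced_ends adj x}.
  by move=> x /(allP good_vertices)/and4P[_ _ _ /distinct_from_uniq[]].
apply: (@adj_list_kg_graph _ _ _ cycle7 _ adj_vertices) => //.
- by move=> x /(allP good_vertices)/and4P[? /eqP].
- by move=> x y /(allP good_vertices)/and4P[_ _ /allP sym_x _] _ /sym_x.
- by apply/allP; vm_compute.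
Qed.

(** Well-ordering of the naturals, with [classic] deciding whether [n] is the order of a graph. *)
Lemma min_order_exists k g (T : finType) (e : rel T) :
  kg_graph k g e -> exists n, is_min_order k g n /\ n <= #|T|.
Proof.
pose P n := exists (T : finType) (e : rel T), kg_graph k g e /\ #|T| = n.
move=> Ge; have PT : P #|T| by exists T, e.
have [//|n [[Pn min_n] _]] :=
  dec_inh_nat_subset_has_unique_least_element P (fun n => classic (P n)).
  by exists #|T|.
exists n; split; last exact/leP/min_n.
by split=> // T' e' Ge'; apply/leP/min_n; exists T', e'.
Qed.

Theorem mainTheorem8 :
  (exists n : nat, is_min_order 8 7 n /\ n <= 774) /\
  (exists (T : finType) (e : rel T), kg_graph 8 7 e /\ #|T| <= 774).
Proof.
have card_T : #|{: seq_sub vertices}| = 774.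
  by rewrite (card_seq_sub uniq_vertices) size_vertices.
split; first by rewrite -card_T; apply: min_order_exists adj_kg_graph.
by exists (seq_sub vertices), (relpre val (grel adj)); rewrite card_T; split;
  first exact: adj_kg_graph.
Qed.
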